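(* For $L=1$ (a single source) and fixed $N$, the CRB ratio between the best classical design and the best FAS design satisfies $$\frac{\mathrm{CRB}_{\mathrm{classical}}^*}{\mathrm{CRB}_{\mathrm{FAS}}^*}=\frac{\mu_2^{\mathrm{FAS}}}{\mu_2^{\mathrm{classical}}}\ge\frac{D^2/4}{\mu_2^{\mathrm{classical}}},$$ where $\mu_2^{\mathrm{classical}}\le D_c^2/4$ with $D_c=O(N^2d_0)$ being the classical array aperture. When $D\gg N^2d_0$, this ratio grows as $O(D^2/(N^4d_0^2))$.
   Context: Fix a wavelength $\lambda>0$, $d_0=\lambda/2$, $D>0$, a number of antennas $N$, noise power $\sigma^2>0$, source power $P_s>0$, number of snapshots $N_p\ge 1$, and a source angle $\theta\in(-\pi/2,\pi/2)$. For positions $p_1,\dots,p_N$ put $\bar p=\frac1N\sum_np_n$ and $\mu_2(\{p_n\})=\frac1N\sum_{n=1}^N(p_n-\bar p)^2$. The single-source Fisher information is $$F(\theta;\{p_n\})=\frac{2N_pP_s}{\sigma^2}\cdot\frac{4\pi^2\cos^2\theta}{\lambda^2}\cdot N\,\mu_2(\{p_n\}),$$ and the Cramér–Rao bound is $\mathrm{CRB}(\theta)=1/F(\theta)$. An FAS (fluid antenna system) design is any choice of $p_1,\dots,p_N\in[0,D]$; $\mathrm{CRB}_{\mathrm{FAS}}^*$ is the smallest CRB over all FAS designs and $\mu_2^{\mathrm{FAS}}$ is the value of $\mu_2$ at the best FAS design. A classical design is an $N$-element sparse array on the half-wavelength grid $d_0\mathbb{Z}$ of nested, coprime or minimum redundancy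 type; the aperture $D_c$ of such an array (the difference between its largest and smallest position) scales as $O(N^2d_0)$. $\mathrm{CRB}_{\mathrm{classical}}^*$ is the smallest CRB over classical designs and $\mu_2^{\mathrm{classical}}$ is the value of $\mu_2$ at the best classical design. Nested array with $N=N_1+N_2$ elements: positions $\{d_0,\dots,N_1d_0\}\cup\{m(N_1+1)d_0:1\le m\le N_2\}$. Coprime array: for coprime positive integers $M,N'$, positions $\{Mnd_0:0\le n\le N'-1\}\cup\{N'md_0:0\le m\le M-1\}$, with $N=M+N'-1$. Minimum redundancy array: an $N$-element grid array maximizing the largest $M_c$ such that $\{-M_cd_0,\dots,M_cd_0\}$ is contained in its set of pairwise differences.
   Formalization: The bound (D²/4)/μ₂^classical is false for odd N (N=3: the best μ₂^FAS is 2D²/9), so for odd N it carries the sharp factor 1−1/N²; N≥2 is assumed, and D_c=O(N²d₀) is taken from the context for minimum redundancy arrays only. *)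

(* Defs.v *)
From mathcomp Require Import all_boot all_order all_algebra.
From mathcomp Require Import all_classical all_reals all_analysis.
Set Implicit Arguments.
Unset Strict Implicit.
Unset Printing Implicit Defensive.
Import Order.TTheory GRing.Theory Num.Theory.
Local Open Scope classical_set_scope.
Local Open Scope ring_scope.

Section Bound.
Context {R : realType} {N : nat}.
Implicit Types p : 'I_N -> R.

Definition mean p : R := N%:R^-1 * \sum_i p i.

Definition mu2 p : R := N%:R^-1 * \sum_i (p i - mean p) ^+ 2.

Definition fisher (lambda sigma2 Ps theta : R) (Np : nat) p : R :=
  2 * Np%:R * Ps / sigma2 * (4 * pi ^+ 2 * cos theta ^+ 2 / lambda ^+ 2)
  * N%:R * mu2 p.

(* Extended-real inverse: a design carrying no information (all antennas at
   the same point) has CRB +oo, whereas the inverse of 0 in R is 0. *)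
Definition CRB (lambda sigma2 Ps theta : R) (Np : nat) p : \bar R :=
  ((fisher lambda sigma2 Ps theta Np p)%:E^-1)%E.

Definition aperture p : R := sup (range p) - inf (range p).

Definition best_design (design : set ('I_N -> R)) (crb : ('I_N -> R) -> \bar R)
    p : Prop :=
  design p /\ forall q, design q -> (crb p <= crb q)%E.

Definition FAS_design (D : R) : set ('I_N -> R) :=
  [set p | forall i, 0 <= p i <= D].

Definition on_grid (d0 : R) (k : 'I_N -> int) : 'I_N -> R :=
  fun i => d0 * (k i)%:~R.

End Bound.

Section Classical.
Context {N : nat}.
Implicit Types k : 'I_N -> int.

(* Arrays are given by their grid indices, in units of the spacing d0; the
   order in which the antennas are listed is immaterial. *)

Definition nested_array k : Prop :=
  exists N1 N2 : nat,
    [/\ N = (N1 + N2)%N, injective k &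
        range k =
          [set n%:Z | n in [set n | (1 <= n <= N1)%N]] `|`
          [set (m * N1.+1)%N%:Z | m in [set m | (1 <= m <= N2)%N]]].

Definition coprime_array k : Prop :=
  exists M N' : nat,
    [/\ [/\ (0 < M)%N, (0 < N')%N & coprime M N'],
        N = (M + N' - 1)%N, injective k &
        range k =
          [set (M * n)%N%:Z | n in [set n | (n < N')%N]] `|`
          [set (N' * m)%N%:Z | m in [set m | (m < M)%N]]].

Definition covers_lags k (m : nat) : Prop :=
  forall z : int, `|z| <= m%:Z -> exists i j : 'I_N, k i - k j = z.

Definition largest_lag k (m : nat) : Prop :=
  covers_lags k m /\ forall m', covers_lags k m' -> (m' <= m)%N.

Definition min_redundancy_array k : Prop :=
  injective k /\
  exists2 m, largest_lag k m &
    forall k' m', injective k' -> largest_lag k' m' -> (m' <= m)%N.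

Definition classical_array k : Prop :=
  [\/ nested_array k, coprime_array k | min_redundancy_array k].

Definition classical_design {R : realType} (d0 : R) : set ('I_N -> R) :=
  [set on_grid d0 k | k in classical_array].

End Classical.

(* Main.v *)
(* Both bounds are positive multiples of 1 / mu2, so the best designs maximize
   mu2 and the ratio of the bounds is the ratio of the mu2's. On the FAS side,
   mu2 <= D^2/4 for every array in [0, D], while putting half of the antennas
   at each end gives D^2/4, or (1 - 1/N^2) D^2/4 when N is odd. On the classical
   side, mu2 <= Dc^2/4 with Dc = O(N^2 d0), and a balanced nested array already
   has mu2 of order N^4 d0^2, so mu2 is of that exact order at the optimum. *)
Require Import Defs.
From mathcomp Require Import all_boot all_order all_algebra.
From mathcomp Require Import all_classical all_reals all_analysis.
From mathcomp Require Import ring lra zify.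
Set Implicit Arguments.
Unset Strict Implicit.
Unset Printing Implicit Defensive.
Import Order.TTheory GRing.Theory Num.Theory.
Import numFieldNormedType.Exports.
Local Open Scope classical_set_scope.
Local Open Scope ring_scope.

(** * Second moment of a point configuration, and its maximum over [[0, D]] *)

Section SecondMoment.
Context {R : realType} {N : nat}.
Hypothesis N_gt0 : (0 < N)%N.
Implicit Types (p : 'I_N -> R) (a b c : R).

Let N_neq0 : N%:R != 0 :> R.
Proof. by rewrite pnatr_eq0 -lt0n. Qed.

Let sum_sqB p c : \sum_i (p i - c) ^+ 2 =
  \sum_i p i ^+ 2 - 2 * c * \sum_i p i + N%:R * c ^+ 2.
Proof.
rewrite (eq_bigr (fun i => p i ^+ 2 - 2 * c * p i + c ^+ 2)); last first.
  by move=> i _; ring.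
rewrite big_split /= sumrB -mulr_sumr sumr_const card_ord.
by rewrite [N%:R * _]mulr_natl.
Qed.

Lemma mu2E p : mu2 p = N%:R^-1 * (\sum_i p i ^+ 2) - mean p ^+ 2.
Proof.
rewrite /mu2 sum_sqB.
have -> : \sum_i p i = N%:R * mean p by rewrite /mean mulrA divff ?mul1r.
by field.
Qed.

(** Parallel axis identity: deviations from the mean sum to zero, so no cross term survives. *)
Lemma mean_sqB p c :
  N%:R^-1 * \sum_i (p i - c) ^+ 2 = mu2 p + (mean p - c) ^+ 2.
Proof.
rewrite mu2E sum_sqB.
have -> : \sum_i p i = N%:R * mean p by rewrite /mean mulrA divff ?mul1r.
by field.
Qed.

Lemma mu2_ge0 p : 0 <= mu2 p.
Proof. by rewrite mulr_ge0 ?invr_ge0 ?sumr_ge0// => i _; rewrite sqr_ge0. Qed.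

(** Popoviciu's inequality: replacing the mean by the midpoint can only increase the second moment,
    and every point is within [(b - a) / 2] of the midpoint. *)
Lemma mu2_le_itv p a b : (forall i, a <= p i <= b) ->
  mu2 p <= (b - a) ^+ 2 / 4.
Proof.
move=> pab; apply: (@le_trans _ _ (mu2 p + (mean p - (a + b) / 2) ^+ 2)).
  by rewrite lerDl sqr_ge0.
rewrite -mean_sqB ler_pdivrMl ?ltr0n//.
rewrite mulr_natl -[in leRHS](card_ord N) -sumr_const.
by apply: ler_sum => i _; have /andP[] := pab i; nra.
Qed.

Lemma mu2_gt0 p (i j : 'I_N) : p i != p j -> 0 < mu2 p.
Proof.
move=> pij; rewrite lt0r mu2_ge0 andbT; apply: contra pij.
rewrite mulf_eq0 invr_eq0 (negbTE N_neq0) /= psumr_eq0; last first.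
  by move=> k _; rewrite sqr_ge0.
move=> /allP h.
have pm k : p k = mean p.
  by apply/eqP; rewrite -subr_eq0 -sqrf_eq0; apply: (implyP (h k _)); rewrite ?mem_index_enum.
by rewrite !pm.
Qed.

Let range_neq0 p : range p !=set0.
Proof. by exists (p (Ordinal N_gt0)); exists (Ordinal N_gt0). Qed.

Lemma aperture_le p a b : (forall i, a <= p i <= b) -> aperture p <= b - a.
Proof.
move=> pab; apply: lerB.
- by apply: ge_sup => // _ [i _ <-]; case/andP: (pab i).
- by apply: lb_le_inf => // _ [i _ <-]; case/andP: (pab i).
Qed.

Let range_itv p i : inf (range p) <= p i <= sup (range p).
Proof.
(* [sup] and [inf] are informative only on bounded sets; this sum bounds the range. *)
have pS j : `|p j| <= \sum_k `|p k|.
  by rewrite (bigD1 j)//= lerDl sumr_ge0.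
apply/andP; split.
- apply: ge_inf; last by exists i.
  exists (- \sum_k `|p k|) => _ [j _ <-].
  by have := pS j; rewrite ler_norml => /andP[].
- apply: ub_le_sup; last by exists i.
  exists (\sum_k `|p k|) => _ [j _ <-].
  by have := pS j; rewrite ler_norml => /andP[].
Qed.

Lemma mu2_le_aperture p : mu2 p <= aperture p ^+ 2 / 4.
Proof. exact/mu2_le_itv/range_itv. Qed.

Lemma aperture_ge0 p : 0 <= aperture p.
Proof.
have /andP[] := range_itv p (Ordinal N_gt0).
by rewrite subr_ge0; apply: le_trans.
Qed.

(** This is the variance of [D] times a Bernoulli variable of parameter [h / N]; an indicator equals
    its own square. *)
Lemma mu2_two_point (D : R) (h : nat) : (h <= N)%N ->
  mu2 (fun i : 'I_N => D * (i < h)%N%:R) =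
  D ^+ 2 * (h%:R * (N - h)%:R) / N%:R ^+ 2.
Proof.
move=> hN.
have sumh : \sum_(i < N) (i < h)%N%:R = h%:R :> R.
  rewrite -natr_sum -[in RHS](card_ord h) -sum1_card (big_ord_widen N (fun=> 1%N)) //.
  by rewrite [in RHS]big_mkcond; congr (_%:R); apply: eq_bigr => i _; case: ifP.
rewrite mu2E /mean -mulr_sumr sumh.
rewrite (eq_bigr (fun i : 'I_N => D ^+ 2 * (i < h)%N%:R)); last first.
  by move=> i _; case: (i < h)%N; rewrite /= ?mulr1 ?mulr0 ?expr0n.
rewrite -mulr_sumr sumh natrB//.
by field.
Qed.

(** In the product topology the cube [FAS_design D] is compact by Tychonoff, so the continuous [mu2]
    attains its maximum there. *)
Let points : topologicalType := prod_topology (fun _ : 'I_N => R).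

Let continuous_mu2 : continuous (mu2 : points -> R).
Proof.
have projc (i : 'I_N) : continuous (fun p : points => p i : R).
  exact: (@proj_continuous _ (fun=> R)).
have avgc (F : 'I_N -> points -> R) : (forall i, continuous (F i)) ->
    continuous (fun p : points => N%:R^-1 * \sum_i F i p).
  move=> Fc p; apply: (@continuousM R points (fun=> N%:R^-1)); first exact: cst_continuous.
  by apply: continuous_big => //; apply: add_continuous.
have subc i : continuous (fun p : points => p i - mean p).
  by move=> p; apply: (@continuousB _ _ _ (fun p : points => p i : R));
    [apply: projc|apply: avgc => j; apply: projc].
by apply: avgc => i p; exact: (@continuousM R points _ _ p (subc i p) (subc i p)).
Qed.

Lemma mu2_FAS_max (D : R) : 0 <= D ->
  exists2 p : 'I_N -> R, FAS_design D p &
    forall q : 'I_N -> R, FAS_design D q -> mu2 q <= mu2 p.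
Proof.
move=> D0.
have FASc : compact (FAS_design D : set points).
  rewrite (_ : FAS_design D =
      [set p : points | forall i : 'I_N, `[0, D]%classic (p i)]).
    exact: (@tychonoff _ (fun=> R) _ (fun=> @segment_compact R 0 D)).
  by apply/seteqP; split=> p /= h i; have := h i; rewrite in_itv.
have FAS0 : (FAS_design D : set points) !=set0.
  by exists (fun=> 0) => i; rewrite lexx.
have mu2c : {within (FAS_design D : set points), continuous (mu2 : points -> R)}.
  exact/continuous_subspaceT/continuous_mu2.
have [p pD pmax] := compact_EVT_max FAS0 FASc mu2c.
exists p; first by rewrite inE in pD.
by move=> q qD; apply: pmax; rewrite inE.
Qed.

(** Comparison with [N./2] antennas at [D] and the others at 0. For odd [N], [h = (N - 1) / 2] gives
    [h (N - h) / N^2 = (1 - 1 / N^2) / 4]. *)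
Lemma mu2_FAS_max_ge (D : R) p : 0 <= D ->
    (forall q : 'I_N -> R, FAS_design D q -> mu2 q <= mu2 p) ->
  (if odd N then (1 - (N%:R ^+ 2)^-1) * (D ^+ 2 / 4) else D ^+ 2 / 4) <= mu2 p.
Proof.
move=> D0 pmax.
have hN : (N./2 <= N)%N by rewrite -divn2 leq_div.
apply: le_trans (pmax (fun i : 'I_N => D * (i < N./2)%N%:R) _); last first.
  by move=> i; case: (_ < _)%N; rewrite /= ?mulr1 ?mulr0 ?lexx ?D0.
rewrite mu2_two_point// natrB//.
have := odd_double_half N; move: (N./2) => h /esym eN.
have N2 : N%:R = (odd N)%:R + 2 * h%:R :> R by rewrite {1}eN natrD -muln2 natrM mulrC.
case: ifP N2 => oN /= N2.
  have -> : h%:R = (N%:R - 1) / 2 :> R by rewrite N2; field.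
  by rewrite le_eqVlt; apply/orP; left; apply/eqP; field.
have -> : h%:R = N%:R / 2 :> R by rewrite N2; field.
by rewrite le_eqVlt; apply/orP; left; apply/eqP; field.
Qed.

End SecondMoment.

(** * From the Cramér-Rao bound to [mu2] *)

Section CramerRao.
Context {R : realType} {N : nat}.
Variables (lambda sigma2 Ps theta : R) (Np : nat).
Hypotheses (lambda_gt0 : 0 < lambda) (sigma2_gt0 : 0 < sigma2) (Ps_gt0 : 0 < Ps)
  (theta_itv : - (pi / 2) < theta < pi / 2) (Np_gt0 : (0 < Np)%N) (N_gt0 : (0 < N)%N).
Implicit Types p q : 'I_N -> R.

Let crb := @CRB R N lambda sigma2 Ps theta Np.
Let gain : R := 2 * Np%:R * Ps / sigma2 *
  (4 * pi ^+ 2 * cos theta ^+ 2 / lambda ^+ 2) * N%:R.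

Let gain_gt0 : 0 < gain.
Proof.
have c0 := cos_gt0_pihalf theta_itv; have pi0 := pi_gt0 R.
by rewrite /gain !mulr_gt0 ?invr_gt0 ?exprn_gt0 ?ltr0n.
Qed.

Let crbE p : crb p = ((gain * mu2 p)%:E^-1)%E.
Proof. by []. Qed.

(** Inversion reverses the order on nonnegative extended reals, also at 0, whose inverse is [+oo];
    designs with [mu2] zero thus rank last. *)
Lemma CRB_le p q : (crb p <= crb q)%E = (mu2 q <= mu2 p).
Proof.
have F0 (r : 'I_N -> R) : (gain * mu2 r)%:E \in [pred x : \bar R | (0 <= x)%E].
  by rewrite inE lee_fin mulr_ge0 ?mu2_ge0 ?(ltW gain_gt0).
by rewrite !crbE lee_pV2// lee_fin ler_pM2l.
Qed.

Lemma CRB_ratio p q : 0 < mu2 p -> 0 < mu2 q ->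
  (crb p / crb q)%E = (mu2 q / mu2 p)%:E.
Proof.
move=> p0 q0; rewrite !crbE inveK inver (gt_eqF (mulr_gt0 gain_gt0 p0)).
rewrite -EFinM; congr EFin.
have p0' : mu2 p != 0 by rewrite gt_eqF.
have g0' : gain != 0 by rewrite gt_eqF.
by rewrite /=; field; rewrite p0' g0'.
Qed.

Lemma best_designP (design : set ('I_N -> R)) p :
  best_design design crb p <->
  design p /\ forall q, design q -> mu2 q <= mu2 p.
Proof.
by split=> -[dp pmin]; split=> // q /pmin; rewrite CRB_le.
Qed.

End CramerRao.

(** * Grid indices of nested and coprime arrays *)

Section Arrays.
Context {N : nat}.
Implicit Types k : 'I_N -> int.

Lemma classical_array_inj k : classical_array k -> injective k.
Proof. by case=> [[N1 [N2 []]]|[M [N' []]]|[]]. Qed.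

(** Once an outer antenna exists, [N1 + 1] and [N2] are both at most [N]. *)
Lemma nested_array_le k : nested_array k -> forall i, 0 <= k i <= (N ^ 2)%N%:Z.
Proof.
move=> [N1 [N2 [eN _ rk]]] i.
have : range k (k i) by exists i.
by rewrite rk => -[[n /= /andP[n1 nN1] <-]|[m /= /andP[m1 mN2] <-]]; nia.
Qed.

Lemma coprime_array_le k : coprime_array k -> forall i, 0 <= k i <= (N ^ 2)%N%:Z.
Proof.
move=> [M [N' [[M0 N'0 _] eN _ rk]]] i.
have : range k (k i) by exists i.
by rewrite rk => -[[n /= nN <-]|[m /= mN <-]]; nia.
Qed.

(** Lists [h] inner antennas first, then the outer ones; the successors turn 0-based ordinals into
    1-based positions. *)
Definition nested_index (h i : nat) : nat :=
  if (i < h)%N then i.+1 else ((i - h).+1 * h.+1)%N.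

Lemma nested_array_index (h : nat) : (h <= N)%N ->
  nested_array (fun i : 'I_N => (nested_index h i)%:Z).
Proof.
move=> hN; exists h, (N - h)%N; split; first by rewrite subnKC.
  (* Inner positions are at most [h] and outer ones at least [h + 1], so the blocks do not meet. *)
  move=> i j [] /eqP; rewrite /nested_index => e; apply/val_inj; move: e => /=.
  case: ltnP => ih; case: ltnP => jh.
  - by move=> /eqP[].
  - by move=> /eqP; nia.
  - by move=> /eqP; nia.
  - by rewrite eqn_pmul2r// => /eqP; lia.
apply/seteqP; split=> [_ [i _ <-]|_ [[n /= /andP[n1 nh] <-]|[m /= /andP[m1 mN] <-]]].
- rewrite /nested_index; case: ltnP => ih; [left|right].
    by exists i.+1.
  by exists (i - h).+1 => //=; have := ltn_ord i; lia.
- have nN : (n.-1 < N)%N by lia.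
  exists (Ordinal nN) => //=; rewrite /nested_index; congr Posz.
  by rewrite ifT; lia.
- have nN : (h + m.-1 < N)%N by lia.
  exists (Ordinal nN) => //=; rewrite /nested_index; congr Posz.
  by rewrite ifF ?addKn ?prednK//; lia.
Qed.

End Arrays.

(** * Aperture and second moment of classical designs *)

Section ClassicalMoment.
Context {R : realType} {N : nat}.
Hypothesis N_gt1 : (1 < N)%N.
Variables (d0 : R) (Cmra : R).
Hypothesis d0_gt0 : 0 < d0.
(** Minimum redundancy arrays are defined through covered lags; their O(N^2 d0) aperture is taken as
    given. *)
Hypothesis mra_aperture : forall k : 'I_N -> int, min_redundancy_array k ->
  aperture (on_grid d0 k) <= Cmra * (N%:R ^+ 2 * d0).

Let N_gt0 : (0 < N)%N. Proof. exact: ltnW. Qed.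

(** Nested and coprime indices lie in [[0, N^2]], which gives constant 1; [Cmra] may have any sign,
    and [|Cmra| + 1] dominates both constants. *)
Lemma classical_aperture_le (p : 'I_N -> R) : classical_design d0 p ->
  aperture p <= (`|Cmra| + 1) * (N%:R ^+ 2 * d0).
Proof.
have Nd0 : 0 <= N%:R ^+ 2 * d0 by rewrite mulr_ge0// ltW.
have grid_le (k : 'I_N -> int) : (forall i, 0 <= k i <= (N ^ 2)%N%:Z) ->
    aperture (on_grid d0 k) <= (`|Cmra| + 1) * (N%:R ^+ 2 * d0).
  move=> kN; apply: (@le_trans _ _ (N%:R ^+ 2 * d0 - 0)).
    apply: aperture_le => // i; have /andP[k0 k1] := kN i.
    rewrite /on_grid mulr_ge0 ?ler0z ?(ltW d0_gt0)//=.
    rewrite mulrC ler_pM2r// -natrX.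
    by rewrite -[leRHS]/(((N ^ 2)%N%:Z)%:~R) ler_int.
  by rewrite subr0 ler_peMl// lerDr.
move=> [k [/nested_array_le kN|/coprime_array_le kN|kmra] <-].
- exact: grid_le.
- exact: grid_le.
- apply: (le_trans (mra_aperture kmra)); rewrite ler_wpM2r//.
  by rewrite (le_trans (ler_norm _))// lerDl.
Qed.

Lemma classical_mu2_gt0 (p : 'I_N -> R) : classical_design d0 p -> 0 < mu2 p.
Proof.
move=> [k /classical_array_inj k_inj <-].
apply: (mu2_gt0 N_gt0 (i := Ordinal N_gt0) (j := Ordinal N_gt1)).
by rewrite /on_grid (inj_eq (mulfI (lt0r_neq0 d0_gt0))) eqr_int (inj_eq k_inj).
Qed.

(** The sum dominates the integral of [x^2] over [[0, n]]; the induction uses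
    [(n + 1)^3 - n^3 <= 3 (n + 1)^2]. *)
Let sum_sqr_ge (n : nat) : n%:R ^+ 3 / 3 <= \sum_(0 <= i < n) (i.+1%:R : R) ^+ 2.
Proof.
elim: n => [|n IHn]; first by rewrite big_nil expr0n mul0r.
rewrite big_nat_recr//=; apply: le_trans (lerD IHn (lexx _)).
rewrite -natr1; have : 0 <= n%:R :> R by []; nra.
Qed.

(* The m-th inner antenna sits at m d0 and the m-th outer one at m (h + 1) d0,
   so whatever the mean, this pair contributes at least (m h d0)^2 / 2. Summing
   over m gives h^5 d0^2 / 6, and h >= N/3, whence 1458 = 6 * 3^5. *)
Lemma mu2_nested_ge :
  N%:R ^+ 4 * d0 ^+ 2 / 1458 <=
  mu2 (on_grid d0 (fun i : 'I_N => (nested_index N./2 i)%:Z)).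
Proof.
set h := N./2; rewrite /mu2; move: (mean _) => c.
(* The second bound relies on [N > 1]: for [N = 1], [h] would be 0. *)
have [hhN Nh] : (h + h <= N)%N /\ (N <= 3 * h)%N.
  by rewrite /h; have := odd_double_half N; case: (odd N); lia.
pose F (i : nat) : R := (d0 * (nested_index h i)%:R - c) ^+ 2.
have F0 i : 0 <= F i by apply: sqr_ge0.
rewrite (_ : \sum_i _ = \sum_(0 <= i < N) F i); last by rewrite big_mkord.
have hN : (h <= N)%N by lia.
(* Index [i] is paired with [i + h]; for odd [N] one outer antenna is dropped. *)
have le1 : \sum_(0 <= i < h) (F i + F (i + h)%N) <= \sum_(0 <= i < N) F i.
  rewrite (@big_cat_nat _ _ _ h 0 N)//= (@big_cat_nat _ _ _ (h + h) h N) ?leq_addl//=.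
  have -> : \sum_(h <= i < h + h) F i = \sum_(0 <= i < h) F (i + h)%N.
    by rewrite -{1}[h]add0n big_addn addnK.
  by rewrite big_split /= addrA lerDl sumr_ge0.
have le2 : d0 ^+ 2 * h%:R ^+ 2 / 2 * \sum_(0 <= i < h) (i.+1%:R : R) ^+ 2 <=
    \sum_(0 <= i < h) (F i + F (i + h)%N).
  rewrite mulr_sumr !big_mkord; apply: ler_sum => i _.
  rewrite /F /nested_index ltn_ord ltnNge leq_addl /= addnK natrM -[h.+1%:R]natr1.
  set x := i.+1%:R; set y := h%:R.
  (* For the two deviations [a] and [b], [(a + b)^2 >= 0] yields [a^2 + b^2 >= (a - b)^2 / 2], where
     [c] cancels. *)
  have := sqr_ge0 ((d0 * x - c) + (d0 * (x * (y + 1)) - c)); nra.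
have h5 : N%:R ^+ 5 <= 243 * h%:R ^+ 5 :> R.
  rewrite (_ : 243 = 3%:R ^+ 5); last by rewrite -natrX.
  by rewrite -exprMn -natrM -!natrX ler_nat leq_exp2r.
rewrite ler_pdivlMl ?ltr0n//; apply: le_trans le1; apply: le_trans le2.
apply: (@le_trans _ _ (d0 ^+ 2 * h%:R ^+ 2 / 2 * (h%:R ^+ 3 / 3))); last first.
  by rewrite ler_wpM2l// divr_ge0// mulr_ge0 ?sqr_ge0.
have d2 : 0 <= d0 ^+ 2 by apply: sqr_ge0.
by have := ler_wpM2l d2 h5; lra.
Qed.

Lemma classical_max_ge (p : 'I_N -> R) :
    (forall q : 'I_N -> R, classical_design d0 q -> mu2 q <= mu2 p) ->
  N%:R ^+ 4 * d0 ^+ 2 / 1458 <= mu2 p.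
Proof.
move=> pmax; apply: le_trans mu2_nested_ge (pmax _ _).
eexists; last reflexivity.
by constructor 1; apply: nested_array_index; rewrite -divn2 leq_div.
Qed.

(* On the grid, N^2 mu2 / d0^2 takes natural number values, so boundedness of
   the aperture suffices for the maximum to be attained, although there are
   infinitely many (translated) minimum redundancy arrays. *)
Lemma mu2_classical_max : exists2 p : 'I_N -> R, classical_design d0 p &
  forall q : 'I_N -> R, classical_design d0 q -> mu2 q <= mu2 p.
Proof.
pose z (k : 'I_N -> int) : int := N%:Z * (\sum_i k i ^+ 2) - (\sum_i k i) ^+ 2.
have N0 : N%:R != 0 :> R by rewrite pnatr_eq0 -lt0n.
have N2 : 0 < N%:R ^+ 2 :> R by rewrite exprn_gt0// ltr0n.
have d2 : 0 < d0 ^+ 2 by rewrite exprn_gt0.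
have mu2z k : mu2 (on_grid d0 k) = d0 ^+ 2 / N%:R ^+ 2 * (z k)%:~R.
  rewrite mu2E// /mean /on_grid -mulr_sumr.
  rewrite (eq_bigr (fun i => d0 ^+ 2 * ((k i) ^+ 2)%:~R)); last first.
    by move=> i _; rewrite exprMn rmorphXn.
  rewrite -mulr_sumr /z rmorphB rmorphM rmorphXn !rmorph_sum /=.
  by field.
have z0 k : 0 <= z k.
  have := mu2_ge0 (on_grid d0 k).
  by rewrite mu2z pmulr_rge0 ?divr_gt0// ler0z.
pose P n := `[< exists2 k, classical_array k & `|z k|%N = n >].
have zE k : (z k)%:~R = `|z k|%N%:R :> R by rewrite natr_absz ger0_norm.
have Pex : exists n, P n.
  exists `|z (fun i => (nested_index N./2 i)%:Z)|%N; apply/asboolP; eexists; last reflexivity.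
  by constructor 1; apply: nested_array_index; rewrite -divn2 leq_div.
(* The aperture bound on [mu2], expressed in the unit [d0^2 / N^2] of [z]. *)
pose B : R := N%:R ^+ 2 * (((`|Cmra| + 1) * N%:R ^+ 2) ^+ 2 / 4).
have B0 : 0 <= B by rewrite mulr_ge0 ?divr_ge0 ?sqr_ge0.
have Pub n : P n -> (n <= Num.Def.archi_bound B)%N.
  move=> /asboolP[k kc <-]; rewrite -(ler_nat R) -zE.
  apply: le_trans (ltW (archi_boundP B0)).
  have le1 := mu2_le_aperture N_gt0 (on_grid d0 k).
  have kd : classical_design d0 (on_grid d0 k) by exists k.
  have le2 := classical_aperture_le kd.
  have ap0 := aperture_ge0 N_gt0 (on_grid d0 k).
  have : mu2 (on_grid d0 k) <= ((`|Cmra| + 1) * (N%:R ^+ 2 * d0)) ^+ 2 / 4.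
    apply: le_trans le1 _; rewrite ler_pM2r ?invr_gt0//.
    by rewrite lerXn2r// nnegrE ?(le_trans ap0).
  rewrite mu2z => le3; rewrite -(ler_pM2l (divr_gt0 d2 N2)).
  apply: le_trans le3 _; rewrite le_eqVlt; apply/orP; left; apply/eqP.
  by rewrite /B; field.
have [n /asboolP[k kc kn] nmax] := ex_maxnP Pex Pub.
exists (on_grid d0 k); first by exists k.
move=> _ [l lc <-]; rewrite !mu2z ler_pM2l ?divr_gt0// !zE ler_nat kn.
by apply: nmax; apply/asboolP; exists l.
Qed.

End ClassicalMoment.

(** * Ratio of the optimal bounds *)

Theorem proposition1 (R : realType)
    (Cmra : R)
    (mra_aperture : forall (n : nat) (k : 'I_n -> int) (d0 : R),
       0 < d0 -> min_redundancy_array k ->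
       aperture (on_grid d0 k) <= Cmra * (n%:R ^+ 2 * d0)) :
  exists Cap K c C : R, [/\ 0 < Cap, 0 < K, 0 < c & 0 < C] /\
  forall (lambda D sigma2 Ps theta : R) (Np N : nat),
    0 < lambda -> 0 < D -> 0 < sigma2 -> 0 < Ps ->
    - (pi / 2) < theta < pi / 2 -> (1 <= Np)%N -> (2 <= N)%N ->
  let d0 := lambda / 2 in
  let crb := @CRB R N lambda sigma2 Ps theta Np in
  [/\ exists p, best_design (FAS_design D) crb p,
      exists q, best_design (classical_design d0) crb q &
      forall pF pC : 'I_N -> R,
        best_design (FAS_design D) crb pF ->
        best_design (classical_design d0) crb pC ->
        let ratio := (crb pC / crb pF)%E in
        let Dc := aperture pC in
        [/\ ratio = (mu2 pF / mu2 pC)%:E,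
            ~~ odd N -> (((D ^+ 2 / 4) / mu2 pC)%:E <= ratio)%E,
            odd N ->
              (((1 - (N%:R ^+ 2)^-1) * ((D ^+ 2 / 4) / mu2 pC))%:E <= ratio)%E,
            mu2 pC <= Dc ^+ 2 / 4 /\ Dc <= Cap * (N%:R ^+ 2 * d0) &
            K * (N%:R ^+ 2 * d0) <= D ->
              ((c * (D ^+ 2 / (N%:R ^+ 4 * d0 ^+ 2)))%:E <= ratio)%E /\
              (ratio <= (C * (D ^+ 2 / (N%:R ^+ 4 * d0 ^+ 2)))%:E)%E]].
Proof.
have Cap0 : 0 < `|Cmra| + 1 by rewrite ltr_wpDl.
have C0 : 0 < 1458 / 4 :> R by lra.
(* With [Cap = |Cmra| + 1], [c] comes from dividing [3/4 * D^2/4] by [Cap^2 N^4 d0^2 / 4], and [C]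
   from dividing [D^2/4] by the nested bound [N^4 d0^2 / 1458]. *)
exists (`|Cmra| + 1), 1, (3 / 4 / (`|Cmra| + 1) ^+ 2), (1458 / 4).
split; first by split=> //; rewrite divr_gt0 ?exprn_gt0.
move=> lambda D sigma2 Ps theta Np N lambda0 D0 sigma20 Ps0 theta_itv Np0 N1 d0 crb.
have N0 : (0 < N)%N by apply: ltnW.
have d00 : 0 < d0 by rewrite divr_gt0.
have bestP design p := @best_designP R N _ _ _ _ _ lambda0 sigma20 Ps0 theta_itv Np0 N0 design p.
have mra k := @mra_aperture N k d0 d00.
split.
- have [p pD pmax] := mu2_FAS_max (N := N) (ltW D0).
  by exists p; apply/bestP.
- have [q qC qmax] := mu2_classical_max N1 d00 mra.
  by exists q; apply/bestP.
move=> pF pC /bestP[pFD pFmax] /bestP[pCd pCmax] ratio Dc.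
have muC0 := classical_mu2_gt0 N1 d00 pCd.
have muFge := mu2_FAS_max_ge N0 (ltW D0) pFmax.
(* As [N >= 2], the odd factor [1 - 1 / N^2] is at least [3 / 4], which serves both parities. *)
have N2 : (N%:R ^+ 2)^-1 <= 1 / 4 :> R.
  rewrite div1r lef_pV2 ?posrE ?exprn_gt0 ?ltr0n// (_ : 4 = 2%:R ^+ 2); last by rewrite -natrX.
  by rewrite lerXn2r ?nnegrE// ler_nat.
have D2 : 0 < D ^+ 2 by rewrite exprn_gt0.
have muF_lb : 3 / 4 * (D ^+ 2 / 4) <= mu2 pF.
  by apply: le_trans muFge; case: ifP => _; nra.
have muF_ub : mu2 pF <= D ^+ 2 / 4.
  by rewrite -[D in leRHS]subr0; apply: mu2_le_itv.
have muF0 : 0 < mu2 pF by apply: lt_le_trans muF_lb; lra.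
have ratioE : ratio = (mu2 pF / mu2 pC)%:E by apply: CRB_ratio.
have Dc_le : Dc <= (`|Cmra| + 1) * (N%:R ^+ 2 * d0) by exact: classical_aperture_le mra _ pCd.
have muC_ub : mu2 pC <= Dc ^+ 2 / 4 by apply: mu2_le_aperture.
have muC_lb := classical_max_ge N1 d00 pCmax.
split => //.
- by rewrite ratioE lee_fin ler_pM2r ?invr_gt0// => /negbTE oN; rewrite oN in muFge.
- by rewrite ratioE lee_fin mulrA ler_pM2r ?invr_gt0// => oN; rewrite oN in muFge.
move=> _; rewrite ratioE !lee_fin.
have x0 : 0 < N%:R ^+ 4 * d0 ^+ 2 by rewrite mulr_gt0 ?exprn_gt0 ?ltr0n.
split.
- rewrite ler_pdivlMr//.
  have muC_le : mu2 pC <= (`|Cmra| + 1) ^+ 2 * (N%:R ^+ 4 * d0 ^+ 2) / 4.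
    apply: le_trans muC_ub _; rewrite ler_pM2r ?invr_gt0//.
    rewrite (_ : N%:R ^+ 4 * _ = (N%:R ^+ 2 * d0) ^+ 2); last by ring.
    by rewrite -exprMn lerXn2r// nnegrE ?(le_trans (aperture_ge0 N0 pC)).
  apply: le_trans muF_lb.
  apply: le_trans (ler_wpM2l _ muC_le) _.
    by rewrite !mulr_ge0 ?invr_ge0// ltW.
  rewrite le_eqVlt; apply/orP; left; apply/eqP; field.
  by rewrite !gt_eqF// ltr0n.
- rewrite ler_pdivrMr//; apply: le_trans muF_ub _.
  have : 0 <= 1458 / 4 * (D ^+ 2 / (N%:R ^+ 4 * d0 ^+ 2)).
    by rewrite mulr_ge0 ?(ltW C0)// divr_ge0 ?ltW.
  move=> /ler_wpM2l/(_ _ _ muC_lb); apply: le_trans.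
  rewrite le_eqVlt; apply/orP; left; apply/eqP; field.
  by rewrite !gt_eqF// ltr0n.
Qed.
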